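(* Let $k,l\ge 1$, $n=k+l$, and let $$H=\begin{pmatrix} A & B\\ B^\star & C\end{pmatrix}\in M_n(\mathbb{C}),\qquad A\in M_k(\mathbb{C}),\ C\in M_l(\mathbb{C}),$$ be Hermitian and positive semidefinite. If $H$ is of maximal rank, then its Moore-Penrose inverse is given by $$H^{+}=\begin{pmatrix} A^{+}+A^{+}B(H/A)^{+}B^\star A^{+} & -A^{+}B(H/A)^{+}\\ -(H/A)^{+}B^\star A^{+} & (H/A)^{+}\end{pmatrix},$$ where $H/A=C-B^\star A^+B$ is the (generalized) Schur complement of $A$ in $H$.
   Context: $B^\star$ denotes the conjugate transpose of $B$, $M^+$ the Moore-Penrose inverse and $N(M)$ the nullspace of a matrix $M$. Maximal rank: the positive semidefinite Hermitian matrix $H=\begin{pmatrix} A & B\\ B^\star & C\end{pmatrix}$ is of maximal rank (with respect to this partition) if $N(H)=N(A)\oplus N(C)$; equivalently, $\operatorname{rank}H=\operatorname{rank}A+\operatorname{rank}C$. *)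

(* Defs.v *)
From mathcomp Require Import all_boot all_order all_algebra.
From mathcomp Require Import complex reals.
Set Implicit Arguments.
Unset Strict Implicit.
Unset Printing Implicit Defensive.
Import Order.TTheory GRing.Theory Num.Theory.
Local Open Scope ring_scope.
Local Open Scope sesquilinear_scope.

(* Throughout, [M ^t*] is the library's conjugate transpose and
   [M \is hermsymmx] says that M = M ^t*. *)

Section Penrose.
Variable C : numClosedFieldType.

(* The order of C is partial, and 0 <= z entails that z is real. *)
Definition psdmx n (M : 'M[C]_n) : Prop :=
  M \is hermsymmx /\ forall x : 'cV[C]_n, 0 <= (x ^t* *m M *m x) 0 0.

(* The four Penrose equations; [pinvmx] of the library is only some
   generalized inverse, which need not satisfy the last two. *)
Definition penrose m n (M : 'M[C]_(m, n)) : pred 'M[C]_(n, m) :=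
  fun X => [&& M *m X *m M == M, X *m M *m X == X,
               (M *m X) ^t* == M *m X & (X *m M) ^t* == X *m M].

Lemma trmxCM m n p (A : 'M[C]_(m, n)) (B : 'M[C]_(n, p)) :
  (A *m B) ^t* = B ^t* *m A ^t*.
Proof. by rewrite trmx_mul map_mxM. Qed.

Lemma gram_unit m n (G : 'M[C]_(m, n)) :
  row_free G -> G *m G ^t* \in unitmx.
Proof.
move=> Gfree; rewrite -row_free_unit -kermx_eq0; apply/rowV0P => u /sub_kermxP.
rewrite mulmxA => uGG; have : (u *m G) *m (u *m G) ^t* = 0.
  by rewrite trmxCM mulmxA uGG mul0mx.
move=> wwC; apply/eqP; rewrite -(mulmx_free_eq0 _ Gfree).
move: (u *m G) wwC => w /matrixP/(_ 0 0); rewrite !mxE.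
under eq_bigr do rewrite !mxE.
move=> /eqP; rewrite psumr_eq0 => [/allP w0|i _]; last exact: mul_conjC_ge0.
apply/eqP/rowP => j; have := w0 j (mem_index_enum j).
by rewrite mxE /= mul_conjC_eq0 => /eqP.
Qed.

Lemma penrose_exists m n (M : 'M[C]_(m, n)) : exists X, penrose M X.
Proof.
have [r [F [G [MFG Ffree Gfree]]]] : exists r (F : 'M[C]_(m, r)) (G : 'M[C]_(r, n)),
    [/\ F *m G = M, row_free (F ^t*) & row_free G].
  exists (\rank M), (col_base M), (row_base M).
  split; [exact: mulmx_base | | exact: row_base_free].
  by rewrite /row_free mxrank_map mxrank_tr; exact: col_base_full.
have GU := gram_unit Gfree.
have FU : F ^t* *m F \in unitmx by have := gram_unit Ffree; rewrite trmxCK.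
have hermV p (A : 'M[C]_p) : A ^t* = A -> (invmx A) ^t* = invmx A.
  by move=> {2}<-; rewrite trmx_inv map_invmx.
pose U := invmx (G *m G ^t*); pose V := invmx (F ^t* *m F).
have UH : U ^t* = U by apply: hermV; rewrite trmxCM trmxCK.
have VH : V ^t* = V by apply: hermV; rewrite trmxCM trmxCK.
exists (G ^t* *m U *m V *m F ^t*).
have MX : M *m (G ^t* *m U *m V *m F ^t*) = F *m V *m F ^t*.
  by rewrite -MFG !mulmxA -[F *m G *m _]mulmxA -[F *m _ *m U]mulmxA mulmxV ?mulmx1.
have XM : G ^t* *m U *m V *m F ^t* *m M = G ^t* *m U *m G.
  rewrite -MFG !mulmxA -(mulmxA _ _ F) -[_ *m V *m _]mulmxA mulVmx //.
  by rewrite mulmx1.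
apply/and4P; split; apply/eqP.
- by rewrite MX -{1}MFG mulmxA -(mulmxA _ _ F) -(mulmxA F V) mulVmx ?mulmx1.
- rewrite XM !mulmxA -(mulmxA _ G) -(mulmxA _ _ U) mulmxV //.
  by rewrite mulmx1.
- by rewrite MX !trmxCM trmxCK VH mulmxA.
- by rewrite XM !trmxCM trmxCK UH mulmxA.
Qed.

Lemma penrose_unique m n (M : 'M[C]_(m, n)) X Y :
  penrose M X -> penrose M Y -> X = Y.
Proof.
move=> /and4P[/eqP X1 /eqP X2 /eqP X3 /eqP X4].
move=> /and4P[/eqP Y1 /eqP Y2 /eqP Y3 /eqP Y4].
have MXY : M *m X = M *m Y.
  by rewrite -{1}Y1 -mulmxA -Y3 -X3 -trmxCM mulmxA X1 Y3.
have XYM : X *m M = Y *m M.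
  by rewrite -{1}Y1 -mulmxA mulmxA -X4 -Y4 -trmxCM -mulmxA (mulmxA M) X1 Y4.
by rewrite -X2 XYM -mulmxA MXY mulmxA Y2.
Qed.

Definition mpinvmx m n (M : 'M[C]_(m, n)) : 'M[C]_(n, m) :=
  xchoose (penrose_exists M).

Lemma mpinvmxP m n (M : 'M[C]_(m, n)) X : penrose M X <-> mpinvmx M = X.
Proof.
have MP : penrose M (mpinvmx M) by exact: xchooseP.
by split=> [|<- //]; exact: penrose_unique.
Qed.

Definition nullspace m n (M : 'M[C]_(m, n)) : pred 'cV[C]_n :=
  fun x => M *m x == 0.

(* External direct sum, with the pair (u, v) identified with [col_mx u v]. *)
Definition dsum k l (U : pred 'cV[C]_k) (V : pred 'cV[C]_l)
  : pred 'cV[C]_(k + l) := fun x => U (usubmx x) && V (dsubmx x).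

Definition maximal_rank k l (H : 'M[C]_(k + l)) : Prop :=
  nullspace H =1 dsum (nullspace (ulsubmx H)) (nullspace (drsubmx H)).

End Penrose.

(* Main.v *)
Require Import Defs.
From mathcomp Require Import all_boot all_order all_algebra.
From mathcomp Require Import complex reals.
Set Implicit Arguments.
Unset Strict Implicit.
Unset Printing Implicit Defensive.
Import Order.TTheory GRing.Theory Num.Theory.
Local Open Scope ring_scope.
Local Open Scope sesquilinear_scope.
Local Open Scope complex_scope.

(** The pseudo-inverse enters a block computation only through the products
    that it absorbs.  If N(M) is contained in N(P), then P annihilates the
    complementary projector 1 - M^+ M, that is, P M^+ M = P
    ([mulmx_mpinv_sub]).  Maximal rank supplies two such inclusions.

    - N(A) is contained in the kernel of B^*: for u in N(A), the vector (u, 0)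
      lies in N(A) + N(C) = N(H), and the second block of H (u, 0) is B^* u.
    - N(S) is contained in N(B), where S = H/A: the first inclusion yields
      A A^+ B = B, so that H (- A^+ B v, v) = (0, S v).  If S v = 0, this vector
      is therefore in N(H), maximal rank puts v in N(C), and then (0, v) in N(H)
      gives B v = 0.

    Hence A A^+ B = B and B S^+ S = B, together with the adjoint identities.
    The classical block elimination for the inverse then goes through, except
    that the product of H and the candidate X is the block diagonal matrix of
    the orthogonal projectors A A^+ and S S^+ instead of the identity.  This
    form makes H X Hermitian, gives H X H = H and X H X = X, and, because H and
    X are Hermitian, shows that X H = (H X)^* = H X, which is the last Penrose
    equation ([penrose_schur_block]). *)

Section SchurComplement.
Variable F : numClosedFieldType.

Lemma mpinvmx_penrose m n (M : 'M[F]_(m, n)) : penrose M (mpinvmx M).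
Proof. exact/mpinvmxP. Qed.

Lemma mulmx_mpinvK m n (M : 'M[F]_(m, n)) : M *m mpinvmx M *m M = M.
Proof. by have /and4P[/eqP] := mpinvmx_penrose M. Qed.

Lemma mpinvmx_mulK m n (M : 'M[F]_(m, n)) :
  mpinvmx M *m M *m mpinvmx M = mpinvmx M.
Proof. by have /and4P[_ /eqP] := mpinvmx_penrose M. Qed.

Lemma mulmx_mpinv_herm m n (M : 'M[F]_(m, n)) :
  (M *m mpinvmx M) ^t* = M *m mpinvmx M.
Proof. by have /and4P[_ _ /eqP] := mpinvmx_penrose M. Qed.

Lemma mpinv_mulmx_herm m n (M : 'M[F]_(m, n)) :
  (mpinvmx M *m M) ^t* = mpinvmx M *m M.
Proof. by have /and4P[_ _ _ /eqP] := mpinvmx_penrose M. Qed.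

(** The adjoint exchanges the last two Penrose equations and preserves each
    of the first two, so uniqueness identifies the two sides. *)
Lemma mpinvmx_trmxC m n (M : 'M[F]_(m, n)) :
  mpinvmx (M ^t*) = (mpinvmx M) ^t*.
Proof.
apply/mpinvmxP/and4P; split; apply/eqP.
- by rewrite -!trmxCM mulmxA mulmx_mpinvK.
- by rewrite -!trmxCM mulmxA mpinvmx_mulK.
- by rewrite -!trmxCM !mpinv_mulmx_herm.
- by rewrite -!trmxCM !mulmx_mpinv_herm.
Qed.

(** A Hermitian matrix commutes with its pseudo-inverse: M M^+ is the adjoint
    of M^+ M, which is itself Hermitian. *)
Lemma mpinvmx_comm n (M : 'M[F]_n) :
  M ^t* = M -> M *m mpinvmx M = mpinvmx M *m M.
Proof.
by move=> MH; rewrite -[RHS]mpinv_mulmx_herm trmxCM MH -mpinvmx_trmxC MH.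
Qed.

(** The columns of 1 - M^+ M lie in the nullspace of M, by M M^+ M = M. *)
Lemma mulmx_mpinv_sub m n p (M : 'M[F]_(m, n)) (P : 'M[F]_(p, n)) :
  (forall v : 'cV_n, M *m v = 0 -> P *m v = 0) -> P *m mpinvmx M *m M = P.
Proof.
move=> MP; apply/esym/eqP; rewrite -subr_eq0 -mulmxA -{1}[P]mulmx1 -mulmxBr.
apply/eqP/matrixP => i j; rewrite [RHS]mxE.
have : P *m col j (1%:M - mpinvmx M *m M) = 0.
  apply: MP; rewrite !colE mulmxA mulmxBr mulmx1 mulmxA mulmx_mpinvK.
  by rewrite subrr mul0mx.
by rewrite colE mulmxA -colE => /matrixP/(_ i 0); rewrite !mxE.
Qed.

Lemma trmxC_block m1 m2 n1 n2 (A : 'M[F]_(m1, n1)) (B : 'M[F]_(m1, n2))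
    (C : 'M[F]_(m2, n1)) (D : 'M[F]_(m2, n2)) :
  (block_mx A B C D) ^t* = block_mx (A ^t*) (C ^t*) (B ^t*) (D ^t*).
Proof. by rewrite tr_block_mx map_block_mx. Qed.

Lemma trmxCB m n (A B : 'M[F]_(m, n)) : (A - B) ^t* = A ^t* - B ^t*.
Proof. by rewrite linearB map_mxB. Qed.

Lemma trmxCD m n (A B : 'M[F]_(m, n)) : (A + B) ^t* = A ^t* + B ^t*.
Proof. by rewrite linearD map_mxD. Qed.

Lemma trmxCN m n (A : 'M[F]_(m, n)) : (- A) ^t* = - A ^t*.
Proof. by rewrite linearN map_mxN. Qed.

Section Blocks.
Variables (k l : nat) (A : 'M[F]_k) (B : 'M[F]_(k, l)) (C : 'M[F]_l).
Let H : 'M[F]_(k + l) := block_mx A B (B ^t*) C.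
Let S : 'M[F]_l := C - B ^t* *m mpinvmx A *m B.

Lemma maximal_rankP :
  maximal_rank H ->
  forall (u : 'cV_k) (v : 'cV_l), H *m col_mx u v = 0 <-> A *m u = 0 /\ C *m v = 0.
Proof.
move=> Hmax u v; have := Hmax (col_mx u v).
rewrite /nullspace /dsum /H block_mxKul block_mxKdr col_mxKu col_mxKd => E.
split=> [/eqP|[/eqP Au /eqP Cv]]; first by rewrite E => /andP[/eqP ? /eqP ?].
by apply/eqP; rewrite E Au Cv.
Qed.

Lemma maximal_rank_kerA (u : 'cV_k) :
  maximal_rank H -> A *m u = 0 -> B ^t* *m u = 0.
Proof.
move=> /maximal_rankP Hmax Au; have /Hmax : A *m u = 0 /\ C *m (0 : 'cV_l) = 0.
  by rewrite mulmx0.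
by rewrite /H mul_block_col !mulmx0 !addr0 -col_mx0 => /eq_col_mx[].
Qed.

Lemma maximal_rank_kerC (v : 'cV_l) :
  maximal_rank H -> C *m v = 0 -> B *m v = 0.
Proof.
move=> /maximal_rankP Hmax Cv; have /Hmax : A *m (0 : 'cV_k) = 0 /\ C *m v = 0.
  by rewrite mulmx0.
by rewrite /H mul_block_col !mulmx0 !add0r -col_mx0 => /eq_col_mx[].
Qed.

(** The vector (- A^+ B v, v) eliminates the first block: H sends it to
    (0, S v). *)
Lemma maximal_rank_kerS (v : 'cV_l) :
  maximal_rank H -> A *m mpinvmx A *m B = B -> S *m v = 0 -> B *m v = 0.
Proof.
move=> Hmax AaB Sv; apply: maximal_rank_kerC => //.
suff /(maximal_rankP Hmax)[] : H *m col_mx (- (mpinvmx A *m B *m v)) v = 0 by [].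
rewrite /H mul_block_col !mulmxN !mulmxA AaB addNr.
by rewrite addrC -mulmxBl Sv col_mx0.
Qed.

(** Block elimination for pseudo-inverses: the hypotheses [AaB] and [BsS] stand
    for the range conditions which are automatic when A and S are invertible. *)
Lemma penrose_schur_block :
  A ^t* = A -> C ^t* = C ->
  A *m mpinvmx A *m B = B -> B *m mpinvmx S *m S = B ->
  penrose H
    (block_mx (mpinvmx A + mpinvmx A *m B *m mpinvmx S *m B ^t* *m mpinvmx A)
              (- (mpinvmx A *m B *m mpinvmx S))
              (- (mpinvmx S *m B ^t* *m mpinvmx A))
              (mpinvmx S)).
Proof.
move=> AH CH AaB BsS; set X := block_mx _ _ _ _.
have aH : (mpinvmx A) ^t* = mpinvmx A by rewrite -mpinvmx_trmxC AH.
have SH : S ^t* = S by rewrite /S trmxCB !trmxCM trmxCK aH CH mulmxA.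
have sH : (mpinvmx S) ^t* = mpinvmx S by rewrite -mpinvmx_trmxC SH.
have HH : H ^t* = H by rewrite /H trmxC_block trmxCK AH CH.
have XH : X ^t* = X.
  by rewrite /X trmxC_block trmxCD !trmxCN !trmxCM trmxCK aH sH !mulmxA.
have SsB : S *m mpinvmx S *m B ^t* = B ^t*.
  by rewrite -{2}BsS !trmxCM sH SH mulmxA.
have CE : C = S + B ^t* *m mpinvmx A *m B by rewrite subrK.
have HX : H *m X = block_mx (A *m mpinvmx A) 0 0 (S *m mpinvmx S).
  rewrite /H /X mulmx_block; congr block_mx.
  - by rewrite mulmxDr mulmxN !mulmxA AaB addrK.
  - by rewrite mulmxN !mulmxA AaB addNr.
  - rewrite CE mulmxDr mulmxN mulmxDl !mulmxA SsB.
    by rewrite opprD addrA addrAC addrK subrr.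
  - by rewrite CE mulmxN mulmxDl !mulmxA addrC addrK.
have HXH : (H *m X) ^t* = H *m X.
  by rewrite HX trmxC_block !mulmx_mpinv_herm !trmx0 !map_mx0.
have XHE : X *m H = H *m X by rewrite -HXH trmxCM HH XH.
apply/and4P; split; apply/eqP => //.
- rewrite HX /H mulmx_block !mul0mx !addr0 !add0r mulmx_mpinvK AaB SsB.
  by congr block_mx; rewrite {1}CE mulmxDr mulmx_mpinvK !mulmxA SsB -CE.
- rewrite -mulmxA HX /X mulmx_block !mulmx0 !addr0 !add0r mulmxDl !mulNmx.
  (* Both projectors are absorbed by the factors A^+ and S^+ next to them. *)
  have aAa p (N : 'M_(p, k)) : N *m mpinvmx A *m (A *m mpinvmx A) = N *m mpinvmx A.
    by rewrite -mulmxA (mulmxA (mpinvmx A)) mpinvmx_mulK.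
  have sSs p (N : 'M_(p, l)) : N *m mpinvmx S *m (S *m mpinvmx S) = N *m mpinvmx S.
    by rewrite -mulmxA (mulmxA (mpinvmx S)) mpinvmx_mulK.
  by rewrite !aAa sSs !mulmxA !mpinvmx_mulK.
- by rewrite XHE.
Qed.

End Blocks.

End SchurComplement.

Theorem proposition4p3 (R : realType) (k l : nat) (hk : (0 < k)%N) (hl : (0 < l)%N)
    (A : 'M[R[i]]_k) (B : 'M[R[i]]_(k, l)) (C : 'M[R[i]]_l) :
  let H : 'M[R[i]]_(k + l) := block_mx A B (B ^t*) C in
  let S : 'M[R[i]]_l := C - B ^t* *m mpinvmx A *m B in
  psdmx H -> maximal_rank H ->
  mpinvmx H =
    block_mx (mpinvmx A + mpinvmx A *m B *m mpinvmx S *m B ^t* *m mpinvmx A)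
             (- (mpinvmx A *m B *m mpinvmx S))
             (- (mpinvmx S *m B ^t* *m mpinvmx A))
             (mpinvmx S).
Proof.
move=> H S [Hherm _] Hmax; apply/mpinvmxP.
have : H ^t* = H by have /is_hermitianmxP := Hherm; rewrite expr0 scale1r.
rewrite {1}/H trmxC_block => /eq_block_mx[AH _ _ CH].
have BaA : B ^t* *m mpinvmx A *m A = B ^t*.
  by apply: mulmx_mpinv_sub => u; exact: maximal_rank_kerA Hmax.
have AaB : A *m mpinvmx A *m B = B.
  by rewrite mpinvmx_comm // -mpinv_mulmx_herm -{1}(trmxCK B) -trmxCM mulmxA
    BaA trmxCK.
apply: penrose_schur_block => //.
by apply: mulmx_mpinv_sub => v; exact: maximal_rank_kerS Hmax AaB.
Qed.
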